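(* Let $X=(\mathbb{C}^n,\|\cdot\|)$ be a complex normed space with a norm that is either a complex polytope norm with a real essential system of vertices or an adjoint complex polytope norm with a real essential system of facets. Suppose that $Y\subseteq X$ is a real subspace for which a minimal projection $P:X\to Y$ is unique. Then $P$ is a real projection (that is, for every $v\in\mathbb{R}^n$ we have $P(v)\in\mathbb{R}^n$) and $P$ is a $2$-strongly unique minimal projection.
   Context: Throughout $n\ge2$ and ''subspace'' means a proper nonzero linear subspace. For $u_1,\dots,u_N\in\mathbb{C}^n$ put $\operatorname{absconv}\{u_1,\dots,u_N\}=\{\sum_j\alpha_ju_j:\ \alpha_j\in\mathbb{C},\ \sum_j|\alpha_j|\le 1\}$. A norm on $\mathbb{C}^n$ is a complex polytope norm if its closed unit ball equals $\operatorname{absconv}\{u_1,\dots,u_N\}$ for some vectors $u_1,\dots,u_N\in\mathbb{C}^n$; a minimal such set of vectors is an essential system of vertices (unique up to permutation and multiplication by scalars of modulus $1$), and it is real if all $u_j\in\mathbb{R}^n$. A norm on $\mathbb{C}^n$ is an adjoint complex polytope norm if $\|x\|=\max_{1\le j\le N}|f_j(x)|$ for all $x\in\mathbb{C}^n$, for some linear functionals $f_1,\dots,f_N:\mathbb{C}^n\to\mathbb{C}$; a minimal such set of functionals is an essential system of facets, and it is real if every $f_j$ maps $\mathbb{R}^n$ into $\mathbb{R}$. A linear subspace of $\mathbb{C}^n$ is a real subspace if it has a basis (over $\mathbb{C}$) consisting of vectors in $\mathbb{R}^n$. A projection $P:X\to Y$ is a linear map with $P(y)=y$ for all $y\in Y$;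 $\|P\|$ is the operator norm. The relative projection constant is $\lambda(Y,X)=\inf\|P\|$ over all linear projections $P:X\to Y$, and $P$ is a minimal projection if $\|P\|=\lambda(Y,X)$. For a real $\alpha\ge1$, a projection $P:X\to Y$ is an $\alpha$-strongly unique minimal projection if there is $r>0$ such that $\|Q\|^\alpha\ge\|P\|^\alpha+r\|Q-P\|^\alpha$ for every linear projection $Q:X\to Y$. *)

(* Defs.v *)
From HB Require Import structures.
From mathcomp Require Import all_boot all_order all_algebra finmap.
From mathcomp Require Import complex.
From mathcomp Require Import classical_sets reals exp.

Set Implicit Arguments.
Unset Strict Implicit.
Unset Printing Implicit Defensive.

Import Order.TTheory GRing.Theory Num.Theory.
Import ComplexField.Normc.

Local Open Scope ring_scope.
Local Open Scope classical_set_scope.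

(* [normc z : R] is the modulus of [z : R[i]]; the library's [`|z|] is the same
   number, but as an element of [R[i]]. A norm on C^n is given explicitly as a
   function [N] because ['rV[R[i]]_n] already carries a canonical norm. *)
Record is_norm (R : realType) (n : nat) (N : 'rV[R[i]]_n -> R) : Prop := IsNorm {
  norm_eq0 : forall x, N x = 0 -> x = 0;
  norm_homog : forall (a : R[i]) (x : 'rV[R[i]]_n), N (a *: x) = normc a * N x;
  norm_triangle : forall x y : 'rV[R[i]]_n, N (x + y) <= N x + N y
}.

Definition real_vector (R : realType) (n : nat) (v : 'rV[R[i]]_n) : Prop :=
  forall j, v 0 j \is Num.real.

Definition unit_ball (R : realType) (n : nat) (N : 'rV[R[i]]_n -> R) :
    set 'rV[R[i]]_n :=
  [set x | N x <= 1].

Definition absconv (R : realType) (n : nat) (U : {fset 'rV[R[i]]_n}) :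
    set 'rV[R[i]]_n :=
  [set x | exists a : 'rV[R[i]]_n -> R[i],
     \sum_(u <- U) normc (a u) <= 1 /\ x = \sum_(u <- U) a u *: u].

Definition vertex_system (R : realType) (n : nat) (N : 'rV[R[i]]_n -> R)
    (U : {fset 'rV[R[i]]_n}) : Prop :=
  unit_ball N = absconv U.

Definition essential_vertices (R : realType) (n : nat) (N : 'rV[R[i]]_n -> R)
    (U : {fset 'rV[R[i]]_n}) : Prop :=
  vertex_system N U /\
  forall U' : {fset 'rV[R[i]]_n}, (U' `<` U)%fset -> ~ vertex_system N U'.

Definition real_polytope_norm (R : realType) (n : nat)
    (N : 'rV[R[i]]_n -> R) : Prop :=
  exists2 U : {fset 'rV[R[i]]_n}, essential_vertices N U &
    forall u, u \in U -> real_vector u.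

(* For nonempty [F] the default value [0] does not affect the maximum of the
   nonnegative numbers [normc (f x)]; the empty [F] would give [N = 0], which is
   not a norm when [0 < n]. *)
Definition facet_system (R : realType) (n : nat) (N : 'rV[R[i]]_n -> R)
    (F : {fset 'Hom('rV[R[i]]_n, (R[i])^o)}) : Prop :=
  forall x, N x = \big[Num.max/0]_(f <- F) normc (f x).

Definition essential_facets (R : realType) (n : nat) (N : 'rV[R[i]]_n -> R)
    (F : {fset 'Hom('rV[R[i]]_n, (R[i])^o)}) : Prop :=
  facet_system N F /\
  forall F' : {fset 'Hom('rV[R[i]]_n, (R[i])^o)},
    (F' `<` F)%fset -> ~ facet_system N F'.

Definition real_functional (R : realType) (n : nat)
    (f : 'Hom('rV[R[i]]_n, (R[i])^o)) : Prop :=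
  forall v, real_vector v -> (f v : R[i]) \is Num.real.

Definition real_adjoint_polytope_norm (R : realType) (n : nat)
    (N : 'rV[R[i]]_n -> R) : Prop :=
  exists2 F : {fset 'Hom('rV[R[i]]_n, (R[i])^o)}, essential_facets N F &
    forall f, f \in F -> real_functional f.

Definition proper_nonzero (R : realType) (n : nat)
    (Y : {vspace 'rV[R[i]]_n}) : Prop :=
  Y <> 0%VS /\ Y <> fullv.

Definition real_subspace (R : realType) (n : nat)
    (Y : {vspace 'rV[R[i]]_n}) : Prop :=
  exists2 b : seq 'rV[R[i]]_n, basis_of Y b &
    forall v, v \in b -> real_vector v.

(* A projection X -> Y is represented as an endomorphism of X with values
   in Y. *)
Definition projection (R : realType) (n : nat) (Y : {vspace 'rV[R[i]]_n})
    (P : 'End('rV[R[i]]_n)) : Prop :=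
  (forall x, P x \in Y) /\ (forall y, y \in Y -> P y = y).

Definition op_norm (R : realType) (n : nat) (N : 'rV[R[i]]_n -> R)
    (P : 'End('rV[R[i]]_n)) : R :=
  sup [set N (P x) | x in unit_ball N].

Definition proj_const (R : realType) (n : nat) (N : 'rV[R[i]]_n -> R)
    (Y : {vspace 'rV[R[i]]_n}) : R :=
  inf [set op_norm N P | P in [set P | projection Y P]].

Definition minimal_projection (R : realType) (n : nat) (N : 'rV[R[i]]_n -> R)
    (Y : {vspace 'rV[R[i]]_n}) (P : 'End('rV[R[i]]_n)) : Prop :=
  projection Y P /\ op_norm N P = proj_const N Y.

Definition real_projection (R : realType) (n : nat)
    (P : 'End('rV[R[i]]_n)) : Prop :=
  forall v, real_vector v -> real_vector (P v).

Definition strongly_unique_minimal (R : realType) (n : nat) (alpha : R)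
    (N : 'rV[R[i]]_n -> R) (Y : {vspace 'rV[R[i]]_n})
    (P : 'End('rV[R[i]]_n)) : Prop :=
  projection Y P /\
  exists2 r : R, 0 < r &
    forall Q, projection Y Q ->
      op_norm N Q `^ alpha >=
        op_norm N P `^ alpha + r * op_norm N (Q - P) `^ alpha.

(* Main.v *)
(* Restricted to real operators, the operator norm is the maximum of finitely
   many real linear functionals: the epigraph of a norm with real vertices
   (resp. real facets) is a cone that has both finitely many generators and
   finitely many bounding half-spaces, and the norm of a real operator is
   already determined by the real vectors.  The real part of P is a minimal
   projection as well, so by uniqueness P is real.  Let I be the set of the
   functionals that attain ||P|| at P.  Uniqueness of P says that a real
   operator P Z (1 - P) (matrices act on row vectors below, which reverses the
   order of the factors) on which all of I is nonpositive vanishes, hence by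
   Farkas' lemma some positive combination of I vanishes on these operators
   while I separates them.  For Q = P + A + i B the squared moduli of the
   functionals G in I at Q are (||P|| + G A)^2 + (G B)^2; in the weighted sum
   over I the linear terms cancel, and what is left is a multiple of ||P||^2
   plus a positive definite quadratic form in (A, B). *)

Require Import Defs.
From mathcomp Require Import all_boot all_order all_algebra finmap ring lra.
From mathcomp Require Import complex classical_sets reals exp.

Set Implicit Arguments.
Unset Strict Implicit.
Unset Printing Implicit Defensive.

Import Order.TTheory GRing.Theory Num.Theory.
Import ComplexField.Normc.

Local Open Scope ring_scope.

Local Notation Re := complex.Re.
Local Notation Im := complex.Im.

(** * Finitely generated cones *)

(** The Frobenius inner product. It represents linear functionals on matrices by matrices, so
    Farkas' lemma applies to functionals and operators alike. *)
Definition mxdot (R : realFieldType) (p q : nat) (A B : 'M[R]_(p, q)) : R :=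
  \tr (A *m B^T).

Lemma mxdotC (R : realFieldType) (p q : nat) (A B : 'M[R]_(p, q)) :
  mxdot A B = mxdot B A.
Proof. by rewrite /mxdot -mxtrace_tr trmx_mul trmxK. Qed.

Lemma mxdotDr (R : realFieldType) (p q : nat) (A B C : 'M[R]_(p, q)) :
  mxdot A (B + C) = mxdot A B + mxdot A C.
Proof. by rewrite /mxdot linearD /= mulmxDr mxtraceD. Qed.

Lemma mxdotZr (R : realFieldType) (p q : nat) (A B : 'M[R]_(p, q)) (c : R) :
  mxdot A (c *: B) = c * mxdot A B.
Proof. by rewrite /mxdot linearZ /= -scalemxAr mxtraceZ. Qed.

Lemma mxdotDl (R : realFieldType) (p q : nat) (A B C : 'M[R]_(p, q)) :
  mxdot (A + B) C = mxdot A C + mxdot B C.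
Proof. by rewrite mxdotC mxdotDr !(mxdotC C). Qed.

Lemma mxdotZl (R : realFieldType) (p q : nat) (A B : 'M[R]_(p, q)) (c : R) :
  mxdot (c *: A) B = c * mxdot A B.
Proof. by rewrite mxdotC mxdotZr mxdotC. Qed.

Lemma mxdot0r (R : realFieldType) (p q : nat) (A : 'M[R]_(p, q)) :
  mxdot A 0 = 0.
Proof. by rewrite -(scale0r 0) mxdotZr mul0r. Qed.

Lemma mxdotNr (R : realFieldType) (p q : nat) (A B : 'M[R]_(p, q)) :
  mxdot A (- B) = - mxdot A B.
Proof. by rewrite -scaleN1r mxdotZr mulN1r. Qed.

Lemma mxdotNl (R : realFieldType) (p q : nat) (A B : 'M[R]_(p, q)) :
  mxdot (- A) B = - mxdot A B.
Proof. by rewrite mxdotC mxdotNr mxdotC. Qed.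

Lemma mxdot_delta (R : realFieldType) (p q : nat) (A : 'M[R]_(p, q)) i j :
  mxdot (delta_mx i j) A = A i j.
Proof.
rewrite /mxdot /mxtrace (bigD1 i) //= mxE (bigD1 j) //= big1 => [|k kj].
  rewrite !mxE !eqxx mul1r addr0 big1 ?addr0 // => k ki.
  by rewrite mxE big1 // => l _; rewrite !mxE (negPf ki) mul0r.
by rewrite !mxE (negPf kj) andbF mul0r.
Qed.

Lemma mxdot_mulmx (R : realFieldType) (p q r : nat) (A : 'M[R]_(p, q))
    (B : 'M[R]_(q, r)) (C : 'M[R]_(p, r)) :
  mxdot C (A *m B) = mxdot (A^T *m C) B.
Proof. by rewrite /mxdot trmx_mul mulmxA mxtrace_mulC mulmxA. Qed.

Lemma mxdot_suml (R : realFieldType) (p q : nat) (I : Type) (r : seq I)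
    (F : I -> 'M[R]_(p, q)) (A : 'M[R]_(p, q)) :
  mxdot (\sum_(i <- r) F i) A = \sum_(i <- r) mxdot (F i) A.
Proof.
elim: r => [|i r IH]; first by rewrite !big_nil mxdotC mxdot0r.
by rewrite !big_cons mxdotDl IH.
Qed.

(** The adjoint of [Z |-> a *m Z *m b]: a functional restricted to operators of this form becomes a
    functional of the free matrix [Z]. *)
Lemma mxdot_sandwich (R : realFieldType) (n : nat) (G a b Z : 'M[R]_n) :
  mxdot G (a *m Z *m b) = mxdot (a^T *m G *m b^T) Z.
Proof. by rewrite -mulmxA mxdot_mulmx /mxdot trmx_mul mulmxA. Qed.

Lemma mxdot_row_mx (R : realFieldType) (n : nat) (x y : 'rV[R]_n) (s t : R) :
  mxdot (row_mx x s%:M) (row_mx y t%:M) = mxdot x y + s * t :> R.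
Proof.
by rewrite /mxdot tr_row_mx mul_row_col mxtraceD tr_scalar_mx -scalar_mxM
  mxtrace_scalar.
Qed.

(** The recursion peels off one generator, whose coefficient is the variable that a step of
    Fourier-Motzkin elimination removes. *)
Fixpoint cone (R : realFieldType) (V : lmodType R) (us : seq V) (x : V) : Prop :=
  if us is u :: us' then exists2 c : R, 0 <= c & cone us' (x - c *: u)
  else x = 0.

Lemma cone0 (R : realFieldType) (V : lmodType R) (us : seq V) : cone us 0.
Proof.
by elim: us => [|u us IH] //=; exists 0 => //; rewrite scale0r subr0.
Qed.

Lemma coneD (R : realFieldType) (V : lmodType R) (us : seq V) (x y : V) :
  cone us x -> cone us y -> cone us (x + y).
Proof.
elim: us x y => [|u us IH] x y /=; first by move=> -> ->; rewrite addr0.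
move=> [c c0 cx] [d d0 dy]; exists (c + d); first exact: addr_ge0.
by rewrite scalerDl opprD addrACA; exact: IH.
Qed.

Lemma coneZ (R : realFieldType) (V : lmodType R) (us : seq V) (a : R) (x : V) :
  0 <= a -> cone us x -> cone us (a *: x).
Proof.
move=> a0; elim: us x => [|u us IH] x /=; first by move=> ->; rewrite scaler0.
move=> [c c0 cx]; exists (a * c); first exact: mulr_ge0.
by rewrite -scalerA -scalerBr; exact: IH.
Qed.

Lemma cone_gen (R : realFieldType) (V : lmodType R) (us : seq V) (u : V) :
  u \in us -> cone us u.
Proof.
elim: us => [|v us IH] //=; rewrite inE => /predU1P[->|/IH uc].
  by exists 1 => //; rewrite scale1r subrr; exact: cone0.
by exists 0 => //; rewrite scale0r subr0.
Qed.

Lemma cone_sum (R : realFieldType) (V : lmodType R) (us : seq V)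
    (I : eqType) (r : seq I) (F : I -> V) :
  (forall i, i \in r -> cone us (F i)) -> cone us (\sum_(i <- r) F i).
Proof.
by move=> cF; rewrite big_seq; apply: big_ind => //; [exact: cone0|exact: coneD].
Qed.

Lemma cone_coef (R : realFieldType) (V : lmodType R) (us : seq V) (x : V) :
  cone us x -> exists2 c : nat -> R, (forall i, 0 <= c i) &
    x = \sum_(i < size us) c i *: us`_i.
Proof.
elim: us x => [|u us IH] x /=.
  by move=> ->; exists (fun=> 0) => //; rewrite big_ord0.
move=> [c c0 /IH[d d0 xE]].
exists (fun i => if i is j.+1 then d j else c) => [[|i]//|].
by rewrite big_ord_recl /= -xE addrC subrK.
Qed.

Lemma cone_ind (R : realFieldType) (V : lmodType R) (K : V -> Prop)
    (us : seq V) :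
  K 0 -> (forall x y, K x -> K y -> K (x + y)) ->
  (forall c x, 0 <= c -> K x -> K (c *: x)) ->
  (forall u, u \in us -> K u) -> forall x, cone us x -> K x.
Proof.
move=> K0 KD KZ; elim: us => [|u us IH] Ku x /=; first by move=> ->.
move=> [c c0 cx]; rewrite -(subrK (c *: u) x); apply: KD.
  by apply: IH => // v vus; apply: Ku; rewrite inE vus orbT.
by apply: KZ => //; apply: Ku; rewrite mem_head.
Qed.

Lemma cone_dot_ge0 (R : realFieldType) (p q : nat) (us : seq 'M[R]_(p, q)) y x :
  (forall u, u \in us -> 0 <= mxdot y u) -> cone us x -> 0 <= mxdot y x.
Proof.
move=> yus; apply: (cone_ind (K := fun x => 0 <= mxdot y x)) => //.
- by rewrite mxdot0r.
- by move=> u v u0 v0; rewrite mxdotDr addr_ge0.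
- by move=> c u c0 u0; rewrite mxdotZr mulr_ge0.
Qed.

(** Supplies the least coefficient that meets a finite list of lower bounds and the bound [0]; the
    last clause says that one of these is attained. *)
Lemma seq_max0 (R : realFieldType) (s : seq R) :
  exists c, [/\ 0 <= c, forall y, y \in s -> y <= c & c = 0 \/ c \in s].
Proof.
elim: s => [|a s [c [c0 sc cs]]]; first by exists 0; split=> //; left.
have [ac|ca] := leP a c.
  exists c; split=> // [y|]; first by rewrite inE => /predU1P[->//|/sc].
  by case: cs => [|cs]; [left|right; rewrite inE cs orbT].
exists a; split; first exact: le_trans (ltW ca).
  move=> y; rewrite inE => /predU1P[->//|/sc yc]; exact: le_trans (ltW ca).
by right; rewrite mem_head.
Qed.

(* Fourier-Motzkin elimination of the coefficients, one generator at a time. *)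
Lemma cone_halfspaces (R : realFieldType) (p q : nat) (us : seq 'M[R]_(p, q)) :
  exists ws : seq 'M[R]_(p, q),
    forall x, cone us x <-> (forall w, w \in ws -> 0 <= mxdot w x).
Proof.
elim: us => [|u us [ws wsP]] /=.
  exists ([seq delta_mx ij.1 ij.2 | ij : 'I_p * 'I_q] ++
          [seq - delta_mx ij.1 ij.2 | ij : 'I_p * 'I_q]) => x; split.
    by move=> -> w _; rewrite mxdot0r.
  move=> wx; apply/matrixP => i j; rewrite mxE; apply/eqP.
  rewrite eq_le -oppr_ge0 -mxdot_delta -mxdotNl !wx // mem_cat.
    by rewrite (map_f (fun ij => delta_mx ij.1 ij.2) (mem_enum _ (i, j))).
  by rewrite (map_f (fun ij => - delta_mx ij.1 ij.2) (mem_enum _ (i, j))) orbT.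
pose wsp := [seq w <- ws | 0 <= mxdot w u].
pose wsn := [seq w <- ws | mxdot w u < 0].
(* A coefficient [c] of [u] must satisfy [c * mxdot w u <= mxdot w x] for all [w] in [ws], which
   bounds [c] from below for [w] in [wsn] and never for [w] in [wsp]. The pairs compare each lower
   bound with the conditions from [wsp], and [wsp] itself compares these with the bound [0]. *)
exists (wsp ++ [seq mxdot a u *: b - mxdot b u *: a | a <- wsp, b <- wsn]).
move=> x; split.
  move=> [c c0 /wsP cx] w; rewrite mem_cat.
  have wxu v : v \in ws -> c * mxdot v u <= mxdot v x.
    by move=> /cx; rewrite mxdotDr mxdotNr mxdotZr subr_ge0.
  case/orP => [|/allpairsP[[a b] [/= + + ->]]].
    rewrite mem_filter => /andP[wu /wxu]; apply: le_trans.
    exact: mulr_ge0.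
  rewrite !mem_filter => /andP[au /wxu ax] /andP[bu /wxu bx].
  rewrite mxdotDl mxdotNl !mxdotZl; nra.
move=> wx.
have [c [c0 cge cE]] := seq_max0 [seq mxdot b x / mxdot b u | b <- wsn].
exists c => //; apply/wsP => w wws.
rewrite mxdotDr mxdotNr mxdotZr subr_ge0.
have [wu|wu] := leP 0 (mxdot w u).
  have wwsp : w \in wsp by rewrite mem_filter wu.
  case: cE => [->|/mapP[b bwsn ->]].
    by rewrite mul0r wx // mem_cat wwsp.
  have : 0 <= mxdot (mxdot w u *: b - mxdot b u *: w) x.
    apply: wx; rewrite mem_cat.
    by rewrite (allpairs_f (fun a b => mxdot a u *: b - mxdot b u *: a)) ?orbT.
  rewrite mxdotDl mxdotNl !mxdotZl subr_ge0.
  move: bwsn; rewrite mem_filter => /andP[bu _].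
  by rewrite mulrAC ler_ndivrMr // => h; rewrite mulrC [leRHS]mulrC.
have : mxdot w x / mxdot w u <= c.
  by apply/cge/map_f; rewrite mem_filter wu.
by rewrite ler_ndivrMr.
Qed.

(** The half-space normals of [cone us] are nonnegative on every generator, so the hypothesis
    applies to them and places [y] in each half-space. *)
Lemma farkas (R : realFieldType) (p q : nat) (us : seq 'M[R]_(p, q)) y :
  (forall x, (forall u, u \in us -> 0 <= mxdot u x) -> 0 <= mxdot y x) ->
  cone us y.
Proof.
have [ws wsP] := cone_halfspaces us => yge0.
apply/wsP => w wws; rewrite mxdotC; apply: yge0 => u /cone_gen/wsP.
by rewrite mxdotC; apply.
Qed.

(** The normals of the half-spaces that describe [cone ws] generate its dual cone, by Farkas'
    lemma. *)
Lemma halfspaces_cone (R : realFieldType) (p q : nat)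
    (ws : seq 'M[R]_(p, q)) :
  exists us : seq 'M[R]_(p, q),
    forall x, cone us x <-> (forall w, w \in ws -> 0 <= mxdot w x).
Proof.
have [us usP] := cone_halfspaces ws.
exists us => x; split.
  move=> ux w /cone_gen/usP wus; apply: cone_dot_ge0 ux => u uus.
  by rewrite mxdotC wus.
move=> wx; apply: farkas => y uy.
have /usP cy := uy.
by apply: cone_dot_ge0 cy => w /wx; rewrite mxdotC.
Qed.

(** * Norms with real vertices or real facets *)

Definition complex_mx (R : realType) (p q : nat) (A : 'M[R]_(p, q)) :
  'M[R[i]]_(p, q) := map_mx (real_complex R) A.

Definition Re_mx (R : realType) (p q : nat) (M : 'M[R[i]]_(p, q)) :
  'M[R]_(p, q) := map_mx (@Re R) M.

Definition Im_mx (R : realType) (p q : nat) (M : 'M[R[i]]_(p, q)) :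
  'M[R]_(p, q) := map_mx (@Im R) M.

Lemma ReD (R : realType) (x y : R[i]) : Re (x + y) = Re x + Re y.
Proof. by case: x y => [a b] [c d]. Qed.

Lemma ImD (R : realType) (x y : R[i]) : Im (x + y) = Im x + Im y.
Proof. by case: x y => [a b] [c d]. Qed.

Lemma Re_mul_real (R : realType) (x : R[i]) (a : R) :
  Re (x * a%:C%C) = Re x * a.
Proof. by case: x => b c /=; rewrite mulr0 subr0. Qed.

Lemma Im_mul_real (R : realType) (x : R[i]) (a : R) :
  Im (x * a%:C%C) = Im x * a.
Proof. by case: x => b c /=; rewrite mulr0 add0r. Qed.

Lemma Re_sum (R : realType) (I : Type) (r : seq I) (F : I -> R[i]) :
  Re (\sum_(i <- r) F i) = \sum_(i <- r) Re (F i).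
Proof. exact: (big_morph _ (@ReD R)). Qed.

Lemma Im_sum (R : realType) (I : Type) (r : seq I) (F : I -> R[i]) :
  Im (\sum_(i <- r) F i) = \sum_(i <- r) Im (F i).
Proof. exact: (big_morph _ (@ImD R)). Qed.

Lemma complex_mxE (R : realType) (p q : nat) (M : 'M[R[i]]_(p, q)) :
  M = complex_mx (Re_mx M) + 'i%C *: complex_mx (Im_mx M).
Proof. by apply/matrixP => j k; rewrite !mxE [LHS]complexE. Qed.

Lemma complex_mxK (R : realType) (p q : nat) (A : 'M[R]_(p, q)) :
  Re_mx (complex_mx A) = A.
Proof. by apply/matrixP => j k; rewrite !mxE. Qed.

Lemma complex_mxM (R : realType) (p q r : nat) (A : 'M[R]_(p, q))
    (B : 'M[R]_(q, r)) :
  complex_mx (A *m B) = complex_mx A *m complex_mx B.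
Proof. exact: map_mxM. Qed.

Lemma complex_mxD (R : realType) (p q : nat) (A B : 'M[R]_(p, q)) :
  complex_mx (A + B) = complex_mx A + complex_mx B.
Proof. exact: map_mxD. Qed.

Lemma complex_mxN (R : realType) (p q : nat) (A : 'M[R]_(p, q)) :
  complex_mx (- A) = - complex_mx A.
Proof. exact: map_mxN. Qed.

Lemma complex_mxZ (R : realType) (p q : nat) (a : R) (A : 'M[R]_(p, q)) :
  complex_mx (a *: A) = a%:C%C *: complex_mx A.
Proof. exact: map_mxZ. Qed.

Lemma complex_mx1 (R : realType) (n : nat) :
  complex_mx (1%:M : 'M[R]_n) = 1%:M.
Proof. exact: map_mx1. Qed.

Lemma Re_mxD (R : realType) (p q : nat) (A B : 'M[R[i]]_(p, q)) :
  Re_mx (A + B) = Re_mx A + Re_mx B.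
Proof. by apply/matrixP => j k; rewrite !mxE ReD. Qed.

Lemma Im_mxD (R : realType) (p q : nat) (A B : 'M[R[i]]_(p, q)) :
  Im_mx (A + B) = Im_mx A + Im_mx B.
Proof. by apply/matrixP => j k; rewrite !mxE ImD. Qed.

Lemma Re_mxMr (R : realType) (p q r : nat) (M : 'M[R[i]]_(p, q))
    (A : 'M[R]_(q, r)) :
  Re_mx (M *m complex_mx A) = Re_mx M *m A.
Proof.
apply/matrixP => j k; rewrite !mxE Re_sum.
by apply: eq_bigr => l _; rewrite !mxE Re_mul_real.
Qed.

Lemma Im_mxMr (R : realType) (p q r : nat) (M : 'M[R[i]]_(p, q))
    (A : 'M[R]_(q, r)) :
  Im_mx (M *m complex_mx A) = Im_mx M *m A.
Proof.
apply/matrixP => j k; rewrite !mxE Im_sum.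
by apply: eq_bigr => l _; rewrite !mxE Im_mul_real.
Qed.

Lemma Re_mxMl (R : realType) (p q r : nat) (M : 'M[R[i]]_(q, r))
    (A : 'M[R]_(p, q)) :
  Re_mx (complex_mx A *m M) = A *m Re_mx M.
Proof.
apply/matrixP => j k; rewrite !mxE Re_sum.
by apply: eq_bigr => l _; rewrite !mxE mulrC Re_mul_real mulrC.
Qed.

Lemma Im_mxMl (R : realType) (p q r : nat) (M : 'M[R[i]]_(q, r))
    (A : 'M[R]_(p, q)) :
  Im_mx (complex_mx A *m M) = A *m Im_mx M.
Proof.
apply/matrixP => j k; rewrite !mxE Im_sum.
by apply: eq_bigr => l _; rewrite !mxE mulrC Im_mul_real mulrC.
Qed.

Lemma real_vectorE (R : realType) (n : nat) (v : 'rV[R[i]]_n) :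
  real_vector v -> complex_mx (Re_mx v) = v.
Proof. by move=> vR; apply/rowP => j; rewrite !mxE RRe_real. Qed.

Lemma real_vector_complex_mx (R : realType) (n : nat) (x : 'rV[R]_n) :
  real_vector (complex_mx x).
Proof. by move=> j; rewrite mxE complex_real. Qed.

Lemma normc_real (R : realType) (a : R) : normc a%:C%C = `|a|.
Proof. by rewrite /= expr0n addr0 sqrtr_sqr. Qed.

Lemma normci (R : realType) : normc ('i%C : R[i]) = 1.
Proof. by rewrite /= expr0n add0r expr1n sqrtr1. Qed.

Lemma normc_sqrE (R : realType) (z : R[i]) : normc z ^+ 2 = Re z ^+ 2 + Im z ^+ 2.
Proof. by case: z => a b /=; rewrite sqr_sqrtr // addr_ge0 // sqr_ge0. Qed.

Lemma normc_ge0 (R : realType) (z : R[i]) : 0 <= normc z.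
Proof. by case: z => a b /=; rewrite sqrtr_ge0. Qed.

Lemma Re_le_normc (R : realType) (z : R[i]) : `|Re z| <= normc z.
Proof.
by rewrite -(@ler_pXn2r _ 2) ?nnegrE ?normc_ge0 // real_normK ?num_real //
  normc_sqrE lerDl sqr_ge0.
Qed.

Lemma norm0 (R : realType) (n : nat) (N : 'rV[R[i]]_n -> R) :
  is_norm N -> N 0 = 0.
Proof. by move=> NN; rewrite -(scale0r 0) norm_homog // normc0 mul0r. Qed.

Lemma normZ_real (R : realType) (n : nat) (N : 'rV[R[i]]_n -> R) (a : R) x :
  is_norm N -> N (a%:C%C *: x) = `|a| * N x.
Proof. by move=> NN; rewrite norm_homog // normc_real. Qed.

Lemma norm_ge0 (R : realType) (n : nat) (N : 'rV[R[i]]_n -> R) x :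
  is_norm N -> 0 <= N x.
Proof.
move=> NN; have := norm_triangle NN x (- x).
rewrite subrr (norm0 NN) -scaleN1r norm_homog // normcN normc1 mul1r.
by move=> h; lra.
Qed.

Lemma norm_sum (R : realType) (n : nat) (N : 'rV[R[i]]_n -> R) (I : Type)
    (r : seq I) (F : I -> 'rV[R[i]]_n) :
  is_norm N -> N (\sum_(i <- r) F i) <= \sum_(i <- r) N (F i).
Proof.
move=> NN; elim: r => [|i r IH]; first by rewrite !big_nil norm0.
by rewrite !big_cons; apply: le_trans (norm_triangle NN _ _) _; rewrite lerD2l.
Qed.

(** What real vertices and real facets have in common, and all that the later argument uses of the
    norm besides the norm axioms. In the last field the epigraph is a cone in one more dimension,
    the height [t] being the final entry. *)
Record real_polyhedral (R : realType) (n : nat) (N : 'rV[R[i]]_n -> R) : Prop :=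
  RealPolyhedral {
    norm_Re_le : forall z, N (complex_mx (Re_mx z)) <= N z;
    norm_real_operator : forall (A : 'M[R]_n) t, 0 <= t ->
      (forall x, N (complex_mx (x *m A)) <= t * N (complex_mx x)) ->
      forall z, N (z *m complex_mx A) <= t * N z;
    norm_epigraph_cone : exists us : seq 'rV[R]_(n + 1),
      forall x t, N (complex_mx x) <= t <-> cone us (row_mx x t%:M)
  }.

(** Homogeneity rescales [z] into the unit ball; for [t = 0], where this is impossible, [z]
    vanishes. *)
Lemma absconv_coef (R : realType) (n : nat) (N : 'rV[R[i]]_n -> R)
    (U : {fset 'rV[R[i]]_n}) z t :
  is_norm N -> vertex_system N U -> N z <= t ->
  exists2 a : 'rV[R[i]]_n -> R[i], \sum_(u <- U) normc (a u) <= t &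
    z = \sum_(u <- U) a u *: u.
Proof.
move=> NN NU zt.
have t0 : 0 <= t := le_trans (norm_ge0 z NN) zt.
have [t_gt0|t_le0] := ltP 0 t; last first.
  have z0 : z = 0.
    apply: (norm_eq0 NN); apply/eqP; rewrite eq_le norm_ge0 // andbT.
    exact: le_trans zt t_le0.
  exists (fun=> 0); first by rewrite big1 // => u _; rewrite normc0.
  by rewrite z0 big1 // => u _; rewrite scale0r.
have : unit_ball N ((t^-1)%:C%C *: z).
  by rewrite /unit_ball /= normZ_real // ger0_norm ?invr_ge0 // ler_pdivrMl // mulr1.
rewrite NU => -[a [a1 aE]].
exists (fun u => t%:C%C * a u).
  rewrite (eq_bigr (fun u => t * normc (a u))) => [|u _].
    by rewrite -mulr_sumr -[leRHS]mulr1 ler_wpM2l.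
  by rewrite normcM normc_real ger0_norm.
transitivity (t%:C%C *: ((t^-1)%:C%C *: z)).
  by rewrite scalerA -rmorphM /= divff ?lt0r_neq0 // scale1r.
by rewrite aE scaler_sumr; apply: eq_bigr => u _; rewrite scalerA.
Qed.

Lemma vertex_norm_le1 (R : realType) (n : nat) (N : 'rV[R[i]]_n -> R)
    (U : {fset 'rV[R[i]]_n}) u :
  vertex_system N U -> u \in U -> N u <= 1.
Proof.
move=> NU uU; have : absconv U u; last by rewrite -NU.
exists (fun v => if v == u then 1 else 0); split.
  rewrite (bigD1_seq u) //= eqxx normc1 big1 ?addr0 // => v vu.
  by rewrite (negPf vu) normc0.
rewrite (bigD1_seq u) //= eqxx scale1r big1 ?addr0 // => v vu.
by rewrite (negPf vu) scale0r.
Qed.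

(** All three properties are read off from the coefficients of an absolutely convex combination:
    their real parts have no larger moduli, and a real operator needs testing only at the vertices,
    which are real. *)
Lemma vertices_real_polyhedral (R : realType) (n : nat)
    (N : 'rV[R[i]]_n -> R) (U : {fset 'rV[R[i]]_n}) :
  is_norm N -> vertex_system N U -> (forall u, u \in U -> real_vector u) ->
  real_polyhedral N.
Proof.
move=> NN NU UR.
have Usum (b : 'rV[R[i]]_n -> R[i]) (A : 'M[R]_n) t :
    (forall u, u \in U -> N (u *m complex_mx A) <= t) ->
    N ((\sum_(u <- U) b u *: u) *m complex_mx A) <=
      t * \sum_(u <- U) normc (b u).
  move=> uA; rewrite mulmx_suml; apply: le_trans (norm_sum _ _ NN) _.
  rewrite mulr_sumr big_seq [leRHS]big_seq; apply: ler_sum => u uU.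
  by rewrite -scalemxAl norm_homog // mulrC ler_wpM2r ?normc_ge0 // uA.
have ReU (a : 'rV[R[i]]_n -> R[i]) :
    Re_mx (\sum_(u <- U) a u *: u) = \sum_(u <- U) Re (a u) *: Re_mx u.
  rewrite (big_morph (@Re_mx R 1 n) (@Re_mxD R 1 n) (id1 := 0)); last first.
    by apply/matrixP => j k; rewrite !mxE.
  rewrite big_seq [RHS]big_seq; apply: eq_bigr => u /UR uR.
  apply/rowP => j; rewrite !mxE -{1}(RRe_real (uR j)).
  exact: Re_mul_real.
split.
- move=> z; have [a a_le zE] := absconv_coef NN NU (lexx (N z)).
  rewrite {1}zE ReU; apply: le_trans a_le.
  have -> : complex_mx (\sum_(u <- U) Re (a u) *: Re_mx u) =
      (\sum_(u <- U) (Re (a u))%:C%C *: u) *m complex_mx 1%:M.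
    rewrite complex_mx1 mulmx1 (big_morph _ (@complex_mxD R 1 n) (id1 := 0)).
      rewrite big_seq [RHS]big_seq; apply: eq_bigr => u /UR uR.
      by rewrite complex_mxZ real_vectorE.
    exact: map_mx0.
  apply: (@le_trans _ _ (1 * \sum_(u <- U) normc (Re (a u))%:C%C)).
    apply: (Usum (fun u => (Re (a u))%:C%C)) => u uU.
    by rewrite complex_mx1 mulmx1 (vertex_norm_le1 NU).
  rewrite mul1r; apply: ler_sum => u _.
  by rewrite normc_real Re_le_normc.
- move=> A t t0 At z; have [a a_le zE] := absconv_coef NN NU (lexx (N z)).
  rewrite {1}zE; apply: le_trans (ler_wpM2l t0 a_le).
  apply: Usum => u uU; rewrite -(real_vectorE (UR u uU)) -complex_mxM.
  apply: le_trans (At _) _; rewrite real_vectorE; last exact: UR.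
  by rewrite -[leRHS]mulr1 ler_wpM2l // (vertex_norm_le1 NU).
have rowD (x y : 'rV[R]_n) (s t : R) :
    row_mx (x + y) (s + t)%:M = row_mx x s%:M + row_mx y t%:M :> 'rV_(n + 1).
  by rewrite add_row_mx -raddfD.
have rowZ (x : 'rV[R]_n) (s c : R) :
    row_mx (c *: x) (c * s)%:M = c *: row_mx x s%:M :> 'rV_(n + 1).
  by rewrite scale_row_mx scale_scalar_mx.
(* Real coefficients of either sign become nonnegative multiples of [u] and [- u] at height [1]; the
   vertical generator absorbs the slack between [t] and the sum of the moduli. *)
exists (row_mx 0 1%:M :: [seq row_mx (Re_mx u) 1%:M | u <- U] ++
        [seq row_mx (- Re_mx u) 1%:M | u <- U]) => x t.
set us := (X in cone X _); split.
  move=> xt; have [a a_le xE] := absconv_coef NN NU xt.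
  pose s := \sum_(u <- U) `|Re (a u)|.
  have s_le : 0 <= t - s.
    rewrite subr_ge0; apply: le_trans a_le; apply: ler_sum => u _.
    exact: Re_le_normc.
  have xsE : row_mx x s%:M = \sum_(u <- U) row_mx (Re (a u) *: Re_mx u)
      `|Re (a u)|%:M :> 'rV_(n + 1).
    have -> : x = \sum_(u <- U) Re (a u) *: Re_mx u.
      by rewrite -ReU -xE complex_mxK.
    rewrite /s; elim: (enum_fset U) => [|u r IH].
      by rewrite !big_nil raddf0 row_mx0.
    by rewrite !big_cons rowD IH.
  have -> : row_mx x t%:M = (t - s) *: row_mx 0 1%:M +
      \sum_(u <- U) row_mx (Re (a u) *: Re_mx u) `|Re (a u)|%:M :> 'rV_(n + 1).
    by rewrite -xsE -rowZ -rowD scaler0 add0r mulr1 subrK.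
  apply: coneD; first by apply/(coneZ s_le)/cone_gen; rewrite mem_head.
  apply: cone_sum => u uU.
  move: (Re (a u)) => c; have [c0|/ltW c0] := leP 0 c.
    rewrite ger0_norm //.
    have -> : row_mx (c *: Re_mx u) c%:M = c *: row_mx (Re_mx u) 1%:M :> 'rV[R]_(n + 1).
      by rewrite -rowZ mulr1.
    apply/coneZ/cone_gen => //.
    by rewrite inE mem_cat (map_f (fun u => row_mx (Re_mx u) _)) ?orbT.
  rewrite ler0_norm //.
  have -> : row_mx (c *: Re_mx u) (- c)%:M = - c *: row_mx (- Re_mx u) 1%:M :> 'rV[R]_(n + 1).
    by rewrite -rowZ mulr1 scalerN scaleNr opprK.
  apply/coneZ/cone_gen; first by rewrite oppr_ge0.
  by rewrite inE mem_cat (map_f (fun u => row_mx (- Re_mx u) _)) ?orbT.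
pose K (v : 'rV[R]_(n + 1)) := N (complex_mx (lsubmx v)) <= rsubmx v 0 0.
move=> xt; have : K (row_mx x t%:M); last first.
  by rewrite /K row_mxKl row_mxKr mxE eqxx mulr1n.
apply: (cone_ind (K := K) _ _ _ _ xt); rewrite /K {x t xt K}.
- by rewrite !linear0 mxE /complex_mx map_mx0 norm0.
- move=> v w vK wK; rewrite !linearD /= complex_mxD mxE.
  by apply: le_trans (norm_triangle NN _ _) _; rewrite lerD.
- move=> c v c0 vK; rewrite !linearZ /= complex_mxZ normZ_real // mxE.
  by rewrite ger0_norm // ler_wpM2l.
move=> v; rewrite inE mem_cat => /or3P[/eqP->|/mapP[u uU ->]|/mapP[u uU ->]].
- by rewrite row_mxKl row_mxKr mxE eqxx mulr1n /complex_mx map_mx0 norm0.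
- rewrite row_mxKl row_mxKr mxE eqxx mulr1n real_vectorE; last exact: UR.
  exact: vertex_norm_le1 NU _.
rewrite row_mxKl row_mxKr mxE eqxx mulr1n complex_mxN real_vectorE; last exact: UR.
rewrite -scaleN1r norm_homog // normcN normc1 mul1r.
exact: vertex_norm_le1 NU _.
Qed.

Definition functional_row (R : realType) (n : nat)
    (f : 'Hom('rV[R[i]]_n, (R[i])^o)) : 'rV[R]_n :=
  \row_j Re (f (delta_mx 0 j)).

Lemma real_functional_dot (R : realType) (n : nat)
    (f : 'Hom('rV[R[i]]_n, (R[i])^o)) x :
  real_functional f -> f (complex_mx x) = (mxdot (functional_row f) x)%:C%C.
Proof.
move=> fR.
have fdR j : (Re (f (delta_mx 0 j)))%:C%C = f (delta_mx 0 j).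
  apply: RRe_real; apply: fR => k; rewrite mxE.
  by case: (_ && _); rewrite ?rpred1 ?rpred0.
rewrite [complex_mx x]row_sum_delta linear_sum /mxdot trace_mx11 mxE rmorph_sum /=.
apply: eq_bigr => j _; rewrite linearZ /= !mxE rmorphM /= fdR mulrC.
by [].
Qed.

Lemma Re_real_functional (R : realType) (n : nat)
    (f : 'Hom('rV[R[i]]_n, (R[i])^o)) z :
  real_functional f -> Re (f z) = mxdot (functional_row f) (Re_mx z).
Proof.
move=> fR; rewrite {1}(complex_mxE z) linearD linearZ /=.
rewrite !real_functional_dot // ReD /=.
by rewrite !(mul0r, mulr0, mul1r, subr0, addr0).
Qed.

Lemma bigmax0_leP (R : realType) (I : eqType) (r : seq I) (F : I -> R) t :
  0 <= t -> \big[Num.max/0]_(i <- r) F i <= t <-> forall i, i \in r -> F i <= t.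
Proof.
move=> t0; elim: r => [|i r IH]; first by rewrite big_nil.
rewrite big_cons ge_max; split=> [/andP[it /IH rt] j|rt].
  by rewrite inE => /predU1P[->//|/rt].
rewrite rt ?mem_head //; apply/IH => j jr.
by rewrite rt // inE jr orbT.
Qed.

(** A real functional commutes with taking real parts, which yields the first two properties; the
    epigraph is an intersection of half-spaces, hence finitely generated by duality. *)
Lemma facets_real_polyhedral (R : realType) (n : nat)
    (N : 'rV[R[i]]_n -> R) (F : {fset 'Hom('rV[R[i]]_n, (R[i])^o)}) :
  is_norm N -> facet_system N F -> (forall f, f \in F -> real_functional f) ->
  real_polyhedral N.
Proof.
move=> NN NF FR.
have NfP z t : 0 <= t -> (forall f, f \in F -> normc (f z) <= t) <-> N z <= t.
  by move=> t0; rewrite NF; apply: iff_sym; apply: bigmax0_leP.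
have f_le z f : f \in F -> normc (f z) <= N z.
  by move=> fF; have /(NfP _ _ (norm_ge0 z NN)) := lexx (N z); apply.
have Re_le z : N (complex_mx (Re_mx z)) <= N z.
  apply/(NfP _ _ (norm_ge0 z NN)) => f fF.
  apply: le_trans (f_le z f fF).
  rewrite real_functional_dot ?normc_real -?Re_real_functional; try exact: FR.
  exact: Re_le_normc.
split=> //.
- move=> A t t0 At z; have tN0 : 0 <= t * N z by rewrite mulr_ge0 ?norm_ge0.
  apply/(NfP _ _ tN0) => f fF.
  have gE x := real_functional_dot x (FR f fF).
  have [->|fz0] := eqVneq (f (z *m complex_mx A)) 0.
    by rewrite normc0 mulr_ge0 ?norm_ge0.
  (* Rotating [z] makes [f (z *m A)] a nonnegative real, whose value is then
     attained at the real part of the rotated vector. *)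
  pose w := f (z *m complex_mx A).
  pose a := ((normc w)%:C%C / w) *: z.
  have w0 : normc w != 0 by apply: contra_neq fz0 => /eq0_normc.
  have aE : f (a *m complex_mx A) = (normc w)%:C%C.
    by rewrite -scalemxAl linearZ; exact: divfK fz0 _.
  have Na : N a = N z.
    rewrite norm_homog // normcM normcV normc_real ger0_norm ?normc_ge0 //.
    by rewrite divff // mul1r.
  have : normc (f (complex_mx (Re_mx a *m A))) <= t * N (complex_mx (Re_mx a)).
    exact: le_trans (f_le _ _ fF) (At _).
  rewrite gE normc_real -Re_mxMr.
  have -> : mxdot (functional_row f) (Re_mx (a *m complex_mx A)) = normc w.
    by rewrite -Re_real_functional ?aE //; exact: FR.
  rewrite ger0_norm ?normc_ge0 // => /le_trans; apply.
  by rewrite -Na ler_wpM2l.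
have [us usP] := halfspaces_cone (row_mx 0 1%:M ::
  [seq row_mx (functional_row f) 1%:M | f <- F] ++
  [seq row_mx (- functional_row f) 1%:M | f <- F]).
exists us => x t; apply: iff_trans (iff_sym (usP _)); split.
  move=> xt w; rewrite inE mem_cat.
  case/or3P => [/eqP->|/mapP[f fF ->]|/mapP[f fF ->]].
  - rewrite mxdot_row_mx mxdotC mxdot0r add0r mul1r.
    exact: le_trans (norm_ge0 _ NN) xt.
  - have := le_trans (f_le _ f fF) xt.
    rewrite real_functional_dot ?normc_real ?ler_norml; last exact: FR.
    by rewrite mxdot_row_mx; lra.
  have := le_trans (f_le _ f fF) xt.
  rewrite real_functional_dot ?normc_real ?ler_norml; last exact: FR.
  by rewrite mxdot_row_mx mxdotNl; lra.
move=> wx; have t0 : 0 <= t.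
  have := wx _ (mem_head _ _).
  by rewrite mxdot_row_mx mxdotC mxdot0r add0r mul1r.
apply/(NfP _ _ t0) => f fF; rewrite real_functional_dot; last exact: FR.
rewrite normc_real ler_norml.
have := wx (row_mx (functional_row f) 1%:M).
have := wx (row_mx (- functional_row f) 1%:M).
rewrite !inE !mem_cat (map_f (fun f => row_mx (functional_row f) _)) //.
rewrite (map_f (fun f => row_mx (- functional_row f) _)) // !orbT.
move=> /(_ isT) + /(_ isT); rewrite !mxdot_row_mx mxdotNl; lra.
Qed.

Lemma polytope_real_polyhedral (R : realType) (n : nat) (N : 'rV[R[i]]_n -> R) :
  is_norm N -> real_polytope_norm N \/ real_adjoint_polytope_norm N ->
  real_polyhedral N.
Proof.
move=> NN [[U [NU _] UR]|[F [NF _] FR]].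
  exact: vertices_real_polyhedral NU UR.
exact: facets_real_polyhedral NF FR.
Qed.

(** * The norm of a real operator *)

Definition real_op (R : realType) (n : nat) (A : 'M[R]_n) : 'End('rV[R[i]]_n) :=
  linfun (mulmxr (complex_mx A)).

Definition Re_op (R : realType) (n : nat) (L : 'End('rV[R[i]]_n)) : 'M[R]_n :=
  Re_mx (lin1_mx L).

Definition Im_op (R : realType) (n : nat) (L : 'End('rV[R[i]]_n)) : 'M[R]_n :=
  Im_mx (lin1_mx L).

Lemma real_opE (R : realType) (n : nat) (A : 'M[R]_n) z :
  real_op A z = z *m complex_mx A.
Proof. by rewrite lfunE. Qed.

Lemma mulmx_lin1_mx (F : fieldType) (n : nat) (L : 'End('rV[F]_n)) z :
  z *m lin1_mx L = L z.
Proof. exact: mul_rV_lin1. Qed.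

Lemma op_decomp (R : realType) (n : nat) (L : 'End('rV[R[i]]_n)) :
  L = real_op (Re_op L) + 'i%C *: real_op (Im_op L).
Proof.
apply/lfunP => z; rewrite add_lfunE scale_lfunE !real_opE scalemxAr -mulmxDr.
by rewrite -complex_mxE mulmx_lin1_mx.
Qed.

Lemma Re_opK (R : realType) (n : nat) (A : 'M[R]_n) : Re_op (real_op A) = A.
Proof.
rewrite /Re_op -[RHS]complex_mxK; congr Re_mx.
by apply/row_matrixP => j; rewrite !rowE mulmx_lin1_mx real_opE.
Qed.

Lemma Re_opD (R : realType) (n : nat) (L M : 'End('rV[R[i]]_n)) :
  Re_op (L + M) = Re_op L + Re_op M.
Proof.
rewrite /Re_op -Re_mxD; congr Re_mx.
by apply/row_matrixP => j; rewrite !rowE mulmxDr !mulmx_lin1_mx add_lfunE.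
Qed.

Lemma Im_opD (R : realType) (n : nat) (L M : 'End('rV[R[i]]_n)) :
  Im_op (L + M) = Im_op L + Im_op M.
Proof.
rewrite /Im_op -Im_mxD; congr Im_mx.
by apply/row_matrixP => j; rewrite !rowE mulmxDr !mulmx_lin1_mx add_lfunE.
Qed.

Lemma Im_real_op (R : realType) (n : nat) (A : 'M[R]_n) : Im_op (real_op A) = 0.
Proof.
have -> : Im_op (real_op A) = Im_mx (complex_mx A).
  by congr Im_mx; apply/row_matrixP => j; rewrite !rowE mulmx_lin1_mx real_opE.
by apply/matrixP => j k; rewrite !mxE.
Qed.

Lemma real_opD (R : realType) (n : nat) (A B : 'M[R]_n) :
  real_op (A + B) = real_op A + real_op B.
Proof.
by apply/lfunP => z; rewrite add_lfunE !real_opE complex_mxD mulmxDr.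
Qed.

Lemma op_norm_le (R : realType) (n : nat) (N : 'rV[R[i]]_n -> R)
    (L : 'End('rV[R[i]]_n)) t :
  is_norm N -> 0 <= t -> (forall z, N (L z) <= t * N z) -> op_norm N L <= t.
Proof.
move=> NN t0 Lt; apply: ge_sup.
  by exists (N (L 0)), 0 => //; rewrite /unit_ball /= norm0.
by move=> _ [z /= z1 <-]; apply: le_trans (Lt z) _; rewrite -[leRHS]mulr1 ler_wpM2l.
Qed.

Lemma epigraph_gen (R : realType) (n : nat) (N : 'rV[R[i]]_n -> R)
    (us : seq 'rV[R]_(n + 1)) :
  (forall x t, N (complex_mx x) <= t <-> cone us (row_mx x t%:M)) ->
  forall u, u \in us -> N (complex_mx (lsubmx u)) <= rsubmx u 0 0.
Proof.
by move=> usP u uus; apply/usP; rewrite -mx11_scalar hsubmxK; apply: cone_gen.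
Qed.

(** For fixed [A] and [t] the pairs [(v, s)] with [N (complex_mx (v *m A)) <= t * s] form a convex
    cone, so the generators of the epigraph suffice to test the bound. *)
Lemma epigraph_gen_le (R : realType) (n : nat) (N : 'rV[R[i]]_n -> R)
    (us : seq 'rV[R]_(n + 1)) (A : 'M[R]_n) t :
  is_norm N ->
  (forall x s, N (complex_mx x) <= s <-> cone us (row_mx x s%:M)) ->
  (forall u, u \in us ->
     N (complex_mx (lsubmx u *m A)) <= t * rsubmx u 0 0) ->
  forall x, N (complex_mx (x *m A)) <= t * N (complex_mx x).
Proof.
move=> NN usP uA x.
have /usP cx := lexx (N (complex_mx x)).
pose K (v : 'rV[R]_(n + 1)) :=
  N (complex_mx (lsubmx v *m A)) <= t * rsubmx v 0 0.
have : K (row_mx x (N (complex_mx x))%:M); last first.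
  by rewrite /K row_mxKl row_mxKr mxE eqxx mulr1n.
apply: (cone_ind (K := K) _ _ _ uA cx); rewrite /K {x K cx}.
- by rewrite !linear0 mul0mx mxE mulr0 /complex_mx map_mx0 norm0.
- move=> v w vK wK; rewrite !linearD /= mulmxDl complex_mxD mxE mulrDr.
  by apply: le_trans (norm_triangle NN _ _) _; rewrite lerD.
move=> c v c0 vK; rewrite !linearZ /= -scalemxAl complex_mxZ normZ_real // mxE.
by rewrite ger0_norm // mulrCA ler_wpM2l.
Qed.

(** Finitely many generators replace a compactness argument: the sum of the ratios at the generators
    serves as the bound. Boundedness makes the [sup] in [op_norm] a genuine supremum. *)
Lemma real_op_bounded (R : realType) (n : nat) (N : 'rV[R[i]]_n -> R)
    (A : 'M[R]_n) :
  is_norm N -> real_polyhedral N ->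
  exists2 t, 0 <= t & forall z, N (real_op A z) <= t * N z.
Proof.
move=> NN [_ NA [us usP]].
pose F (u : 'rV[R]_(n + 1)) := N (complex_mx (lsubmx u *m A)) / rsubmx u 0 0.
have s_ge0 u : u \in us -> 0 <= rsubmx u 0 0.
  by move=> /(epigraph_gen usP); apply: le_trans; apply: norm_ge0.
have F0 u : u \in us -> 0 <= F u.
  by move=> uus; rewrite divr_ge0 ?norm_ge0 ?s_ge0.
have t0 : 0 <= \sum_(u <- us) F u by rewrite big_seq sumr_ge0.
exists (\sum_(u <- us) F u) => // z; rewrite real_opE; apply: NA => // x.
apply: epigraph_gen_le => // u uus.
(* A generator of height [0] has norm at most [0], so its vector part vanishes and the division by
   [0] in [F] does no harm. *)
have [s0|s_neq0] := eqVneq (rsubmx u 0 0) 0.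
  have := epigraph_gen usP uus; rewrite s0 => N0.
  have -> : lsubmx u = 0.
    rewrite -[lsubmx u]complex_mxK (_ : complex_mx _ = 0).
      by apply/matrixP => j k; rewrite !mxE.
    by apply: (norm_eq0 NN); apply/eqP; rewrite eq_le N0 norm_ge0.
  by rewrite mul0mx /complex_mx map_mx0 norm0 // mulr0.
rewrite -[leLHS](divfK s_neq0) ler_wpM2r ?s_ge0 // -/(F u).
by rewrite (big_rem u) //= lerDl big_seq sumr_ge0 // => v /mem_rem; apply: F0.
Qed.

Lemma op_bounded (R : realType) (n : nat) (N : 'rV[R[i]]_n -> R)
    (L : 'End('rV[R[i]]_n)) :
  is_norm N -> real_polyhedral N ->
  exists2 t, 0 <= t & forall z, N (L z) <= t * N z.
Proof.
move=> NN NP.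
have [s s0 As] := real_op_bounded (Re_op L) NN NP.
have [t t0 Bt] := real_op_bounded (Im_op L) NN NP.
exists (s + t) => [|x]; first exact: addr_ge0.
rewrite {1}(op_decomp L) add_lfunE scale_lfunE mulrDl.
apply: le_trans (norm_triangle NN _ _) _.
by rewrite norm_homog // normci mul1r lerD.
Qed.

Lemma op_norm_sup (R : realType) (n : nat) (N : 'rV[R[i]]_n -> R)
    (L : 'End('rV[R[i]]_n)) z :
  is_norm N -> real_polyhedral N -> N z <= 1 -> N (L z) <= op_norm N L.
Proof.
move=> NN NP z1; apply: ub_le_sup; last by exists z.
have [t t0 Lt] := op_bounded L NN NP.
exists t => _ [y /= y1 <-]; apply: le_trans (Lt y) _.
by rewrite -[leRHS]mulr1 ler_wpM2l.
Qed.

Lemma op_norm_ge0 (R : realType) (n : nat) (N : 'rV[R[i]]_n -> R)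
    (L : 'End('rV[R[i]]_n)) :
  is_norm N -> real_polyhedral N -> 0 <= op_norm N L.
Proof.
move=> NN NP; rewrite -(norm0 NN) -(linear0 L).
by apply: op_norm_sup => //; rewrite norm0.
Qed.

Lemma le_op_norm (R : realType) (n : nat) (N : 'rV[R[i]]_n -> R)
    (L : 'End('rV[R[i]]_n)) z :
  is_norm N -> real_polyhedral N -> N (L z) <= op_norm N L * N z.
Proof.
move=> NN NP.
have [z0|z0] := eqVneq (N z) 0.
  by rewrite (norm_eq0 NN z0) linear0 norm0 // mulr0.
have z_gt0 : 0 < N z by rewrite lt_def z0 norm_ge0.
have NZ y : N ((N z)^-1%:C%C *: y) = (N z)^-1 * N y.
  by rewrite normZ_real // ger0_norm ?invr_ge0 ?ltW.
rewrite -ler_pdivrMr // mulrC -NZ -linearZ /=.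
by apply: op_norm_sup; rewrite ?NZ ?mulVf.
Qed.

Lemma op_normD_le (R : realType) (n : nat) (N : 'rV[R[i]]_n -> R)
    (L M : 'End('rV[R[i]]_n)) :
  is_norm N -> real_polyhedral N ->
  op_norm N (L + M) <= op_norm N L + op_norm N M.
Proof.
move=> NN NP; apply: op_norm_le => // [|z]; first by rewrite addr_ge0 ?op_norm_ge0.
rewrite add_lfunE mulrDl; apply: le_trans (norm_triangle NN _ _) _.
by rewrite lerD ?le_op_norm.
Qed.

Lemma op_normZ_le (R : realType) (n : nat) (N : 'rV[R[i]]_n -> R) (a : R[i])
    (L : 'End('rV[R[i]]_n)) :
  is_norm N -> real_polyhedral N ->
  op_norm N (a *: L) <= normc a * op_norm N L.
Proof.
move=> NN NP; apply: op_norm_le => // [|z].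
  by rewrite mulr_ge0 ?normc_ge0 ?op_norm_ge0.
rewrite scale_lfunE norm_homog // -mulrA.
by rewrite ler_wpM2l ?normc_ge0 ?le_op_norm.
Qed.

(** At a real vector the real part of [L] gives the real part of the value of [L], whose norm is no
    larger; for a real operator a bound on real vectors extends to all vectors. *)
Lemma op_norm_Re_le (R : realType) (n : nat) (N : 'rV[R[i]]_n -> R)
    (L : 'End('rV[R[i]]_n)) :
  is_norm N -> real_polyhedral N ->
  op_norm N (real_op (Re_op L)) <= op_norm N L.
Proof.
move=> NN NP; have L0 := op_norm_ge0 L NN NP.
apply: op_norm_le => // z; rewrite real_opE.
apply: norm_real_operator => // x; apply: le_trans (le_op_norm _ _ NN NP).
by rewrite -Re_mxMl mulmx_lin1_mx; apply: norm_Re_le.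
Qed.

(** The norm is at most [t] iff applying [A] to the vector part of each epigraph generator [u] and
    scaling its height by [t] stays in the epigraph. Each half-space normal [w] turns this into an
    inequality linear in [A] and [t]. *)
Lemma real_op_norm_halfspaces (R : realType) (n : nat) (N : 'rV[R[i]]_n -> R) :
  is_norm N -> real_polyhedral N ->
  exists Gs : seq 'M[R]_n, forall A t, 0 <= t ->
    op_norm N (real_op A) <= t <-> (forall G, G \in Gs -> mxdot G A <= t).
Proof.
move=> NN NP; have [us usP] := norm_epigraph_cone NP.
have [ws wsP] := cone_halfspaces us.
have opP (A : 'M[R]_n) (t : R) : 0 <= t -> op_norm N (real_op A) <= t <->
    (forall u, u \in us -> N (complex_mx (lsubmx u *m A)) <= t * rsubmx u 0 0).
  move=> t0; split=> [At u uus|uA].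
    rewrite complex_mxM -real_opE; apply: le_trans (le_op_norm _ _ NN NP) _.
    by rewrite ler_pM ?op_norm_ge0 ?norm_ge0 ?(epigraph_gen usP).
  apply: op_norm_le => // z; rewrite real_opE.
  by apply: norm_real_operator => //; apply: epigraph_gen_le.
pose b (w : 'rV[R]_(n + 1)) := rsubmx w 0 0.
pose G (u w : 'rV[R]_(n + 1)) : 'M[R]_n := (lsubmx u)^T *m lsubmx w.
have wE u w (A : 'M[R]_n) t : mxdot w (row_mx (lsubmx u *m A) (t * b u)%:M) =
    mxdot (G u w) A + t * (b w * b u).
  rewrite -[w in LHS]hsubmxK [rsubmx w]mx11_scalar mxdot_row_mx mxdot_mulmx.
  by rewrite -/(b w) mulrCA.
have b_us u : u \in us -> 0 <= b u.
  by move=> /(epigraph_gen usP); apply: le_trans; apply: norm_ge0.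
have b_ws w : w \in ws -> 0 <= b w.
  move=> wws; have /usP/wsP/(_ w wws) : N (complex_mx 0) <= 1.
    by rewrite /complex_mx map_mx0 norm0.
  by rewrite -[w in mxdot w _]hsubmxK [rsubmx w]mx11_scalar mxdot_row_mx
    mxdot0r add0r mulr1.
have GP (A : 'M[R]_n) (t : R) : 0 <= t -> op_norm N (real_op A) <= t <->
    (forall u w, u \in us -> w \in ws -> 0 <= mxdot (G u w) A + t * (b w * b u)).
  move=> t0; split=> [/(opP _ _ t0) At u w /At/usP/wsP uw /uw|uw].
    by rewrite wE.
  by apply/(opP _ _ t0) => u uus; apply/usP/wsP => w wws; rewrite wE uw.
(* Dividing by the coefficient of [t] isolates [t]; pairs with coefficient [0] are dropped. *)
exists [seq - (b uw.2 * b uw.1)^-1 *: G uw.1 uw.2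
  | uw <- [seq uw <- allpairs pair us ws | b uw.2 * b uw.1 != 0]].
move=> A t t0; split.
  move=> /(GP _ _ t0) At ? /mapP[[u w] + ->] /=.
  rewrite mem_filter /= => /andP[bwu /allpairsP[[u' w'] /= [uus wws [uE wE']]]].
  subst u' w'.
  have bb : 0 < b w * b u by rewrite lt_def bwu (mulr_ge0 (b_ws w wws) (b_us u uus)).
  have := At u w uus wws.
  by rewrite mxdotZl mulNr lerNl ler_pdivlMl //; lra.
move=> At; apply/(GP _ _ t0) => u w uus wws.
(* A dropped inequality does not involve [t]; it holds because it holds with the norm of [A] in
   place of [t]. *)
have [b0|b0] := eqVneq (b w * b u) 0.
  have s0 := op_norm_ge0 (real_op A) NN NP.
  have := lexx (op_norm N (real_op A)).
  by move=> /(GP _ _ s0)/(_ u w uus wws); rewrite b0 !mulr0.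
have bb : 0 < b w * b u by rewrite lt_def b0 (mulr_ge0 (b_ws w wws) (b_us u uus)).
have : mxdot (- (b w * b u)^-1 *: G u w) A <= t.
  apply: At; apply/mapP; exists (u, w) => //.
  by rewrite mem_filter /= b0 allpairs_f.
by rewrite mxdotZl mulNr lerNl ler_pdivlMl //; lra.
Qed.

(* Applied to the operator [(conjugate of w) *: L], where [w] is the complex
   value of the functional at [L]. *)
Lemma real_functional_sqr_le (R : realType) (n : nat) (N : 'rV[R[i]]_n -> R)
    (G : 'M[R]_n) (L : 'End('rV[R[i]]_n)) :
  is_norm N -> real_polyhedral N ->
  (forall A, mxdot G A <= op_norm N (real_op A)) ->
  mxdot G (Re_op L) ^+ 2 + mxdot G (Im_op L) ^+ 2 <= op_norm N L ^+ 2.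
Proof.
move=> NN NP G_le; set x := mxdot G _; set y := mxdot G _.
pose w : R[i] := (x -i* y)%C.
have w2 : normc w ^+ 2 = x ^+ 2 + y ^+ 2 by rewrite normc_sqrE /= sqrrN.
have wL : Re_op (w *: L) = x *: Re_op L + y *: Im_op L.
  apply/matrixP => j k; rewrite !mxE scale_lfunE mxE.
  by case: (L _ _ _) => c d /=; rewrite mulNr opprK.
have h : x ^+ 2 + y ^+ 2 <= normc w * op_norm N L.
  apply: le_trans (op_normZ_le w L NN NP).
  apply: le_trans (op_norm_Re_le _ NN NP); apply: le_trans (G_le _).
  by rewrite wL mxdotDr !mxdotZr -/x -/y !expr2.
have w0 := normc_ge0 w; have L0 := op_norm_ge0 L NN NP.
move: h; rewrite -w2 => h.
have wleL : normc w <= op_norm N L by rewrite leNgt; apply/negP => lt; nra.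
by rewrite ler_pXn2r ?nnegrE.
Qed.

(** * Strong uniqueness *)

(** An operator [a *m Z *m b] on which all of [I] is nonnegative vanishes, as the hypothesis for
    [- Z] shows. So any [C] is nonnegative there, and Farkas' lemma writes its restriction as a
    nonnegative combination of [I]. *)
Lemma separating_positive_span (R : realFieldType) (n : nat) (a b : 'M[R]_n)
    (I : seq 'M[R]_n) (C : 'M[R]_n) :
  (forall Z, (forall G, G \in I -> mxdot G (a *m Z *m b) <= 0) ->
     a *m Z *m b = 0) ->
  exists2 c : nat -> R, (forall j, 0 <= c j) & forall Z,
    mxdot C (a *m Z *m b) =
    \sum_(j < size I) c j * mxdot I`_j (a *m Z *m b).
Proof.
move=> I0; pose us := [seq a^T *m G *m b^T | G <- I].
have /cone_coef[c c0 cE] : cone us (a^T *m C *m b^T).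
  apply: farkas => Z uZ; rewrite -mxdot_sandwich.
  have : a *m (- Z) *m b = 0.
    apply: I0 => G GI; rewrite mulmxN mulNmx mxdotNr oppr_le0 mxdot_sandwich.
    by apply: uZ; apply: map_f.
  by rewrite mulmxN mulNmx => /eqP; rewrite oppr_eq0 => /eqP->; rewrite mxdot0r.
exists c => // Z; rewrite mxdot_sandwich cE mxdot_suml size_map.
apply: eq_bigr => j _; rewrite mxdotZl mxdot_sandwich.
by rewrite (nth_map 0).
Qed.

(** Constraints that are strict at [x] leave room for a short step in direction [y]; those that are
    tight do not increase along it. *)
Lemma small_step (R : realFieldType) (I : eqType) (s : seq I) (x y : I -> R) t :
  (forall k, k \in s -> x k <= t /\ (x k = t -> y k <= 0)) ->
  exists2 e, 0 < e & forall k, k \in s -> x k + e * y k <= t.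
Proof.
elim: s => [|k s IH] xy; first by exists 1.
have [|e e0 eP] := IH; first by move=> l ls; apply: xy; rewrite inE ls orbT.
have [xk yk] := xy k (mem_head _ _).
have [y0|y_gt0] := leP (y k) 0.
  exists e => // l; rewrite inE => /predU1P[->|/eP//].
  by apply: le_trans xk; rewrite gerDl mulr_ge0_le0 // ltW.
have x_lt : x k < t.
  by rewrite lt_def xk andbT; apply/eqP => xt; have := yk (esym xt); lra.
exists (Num.min e ((t - x k) / y k)).
  by rewrite lt_min e0 divr_gt0 // subr_gt0.
move=> l; rewrite inE => /predU1P[->|ls].
  by rewrite -lerBrDl -ler_pdivlMr // ge_min lexx orbT.
have [y0|yl] := leP (y l) 0.
  have [xl _] := xy l (mem_behead (s := k :: s) ls).
  apply: le_trans xl; rewrite gerDl.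
  by rewrite mulr_ge0_le0 // le_min ltW //= ltW // divr_gt0 // subr_gt0.
apply: le_trans (eP l ls); rewrite lerD2l ler_wpM2r ?(ltW yl) //.
by rewrite ge_min lexx.
Qed.

(** * Projections onto a real subspace *)

Lemma real_subspace_Re (R : realType) (n : nat) (Y : {vspace 'rV[R[i]]_n}) y :
  real_subspace Y -> y \in Y -> complex_mx (Re_mx y) \in Y.
Proof.
move=> [b bY bR] yY.
rewrite (coord_basis (X := in_tuple b) bY yY).
rewrite (big_morph (@Re_mx R 1 n) (@Re_mxD R 1 n) (id1 := 0)); last first.
  by apply/matrixP => j k; rewrite !mxE.
rewrite (big_morph _ (@complex_mxD R 1 n) (id1 := 0)); last exact: map_mx0.
apply: memv_suml => j _; set v := (in_tuple b)`_j; set c := coord _ _ _.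
have vb : v \in b by rewrite /v mem_nth.
have -> : complex_mx (Re_mx (c *: v)) = (Re c)%:C%C *: v.
  apply/rowP => k; rewrite !mxE -[in RHS](RRe_real (bR v vb k)).
  by rewrite -{1}(RRe_real (bR v vb k)) Re_mul_real rmorphM.
by rewrite memvZ // (basis_mem bY).
Qed.

Lemma real_subspace_Im (R : realType) (n : nat) (Y : {vspace 'rV[R[i]]_n}) y :
  real_subspace Y -> y \in Y -> complex_mx (Im_mx y) \in Y.
Proof.
move=> YR yY; have i0 : 'i%C != 0 :> R[i].
  by rewrite eq_complex /= oner_eq0 andbF.
rewrite -[complex_mx _](scalerK i0) memvZ //.
have -> : 'i%C *: complex_mx (Im_mx y) = y - complex_mx (Re_mx y).
  by rewrite {2}(complex_mxE y) addrC addKr.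
by rewrite memvB // real_subspace_Re.
Qed.

(** [Y] contains the real and imaginary parts of its vectors, and [Re_op P] sends a real vector to
    the real part of its image under [P]. *)
Lemma Re_op_projection (R : realType) (n : nat) (Y : {vspace 'rV[R[i]]_n}) P :
  real_subspace Y -> projection Y P -> projection Y (real_op (Re_op P)).
Proof.
move=> YR [PY Pid].
have realE x : real_op (Re_op P) (complex_mx x) =
    complex_mx (Re_mx (P (complex_mx x))).
  by rewrite real_opE -complex_mxM -Re_mxMl mulmx_lin1_mx.
split=> [z|y yY].
  rewrite (complex_mxE z) linearD linearZ /= !realE.
  by rewrite memvD ?memvZ // real_subspace_Re.
rewrite [in LHS](complex_mxE y) linearD linearZ /= !realE !Pid.
- by rewrite !complex_mxK -complex_mxE.
- exact: real_subspace_Im.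
exact: real_subspace_Re.
Qed.

(** In the row convention the factor [1%:M - p] acts first and kills [Y]; the last factor [p] brings
    the values back into [Y]. *)
Lemma projection_perturb (R : realType) (n : nat) (Y : {vspace 'rV[R[i]]_n})
    (p Z : 'M[R]_n) :
  projection Y (real_op p) ->
  projection Y (real_op (p + (1%:M - p) *m Z *m p)).
Proof.
move=> [PY Pid]; split=> [z|y yY]; rewrite real_opD add_lfunE.
  by rewrite memvD // real_opE complex_mxM mulmxA -real_opE.
rewrite Pid // [X in _ + X]real_opE !complex_mxM complex_mxD complex_mxN complex_mx1.
rewrite !mulmxA mulmxBr mulmx1 -[y *m complex_mx p]real_opE Pid //.
by rewrite subrr !mul0mx addr0.
Qed.

(** The difference takes values in [Y] and vanishes on [Y], so it absorbs [p] on the right and is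
    annihilated by [p] on the left; as [p] is real, its real and imaginary parts inherit this. *)
Lemma projection_diff (R : realType) (n : nat) (Y : {vspace 'rV[R[i]]_n})
    (p : 'M[R]_n) (Q : 'End('rV[R[i]]_n)) :
  projection Y (real_op p) -> projection Y Q ->
  let L := Q - real_op p in
  Re_op L = (1%:M - p) *m Re_op L *m p /\ Im_op L = (1%:M - p) *m Im_op L *m p.
Proof.
move=> [PY Pid] [QY Qid] L.
have Lp : lin1_mx L *m complex_mx p = lin1_mx L.
  apply/row_matrixP => j; rewrite !rowE mulmxA mulmx_lin1_mx -real_opE Pid //.
  by rewrite add_lfunE opp_lfunE memvB.
have pL : complex_mx p *m lin1_mx L = 0.
  apply/row_matrixP => j; rewrite !rowE mulmxA mulmx_lin1_mx mulmx0 -real_opE.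
  by rewrite add_lfunE opp_lfunE (Qid _ (PY _)) (Pid _ (PY _)) subrr.
have ReLp : Re_op L *m p = Re_op L by rewrite -Re_mxMr Lp.
have ImLp : Im_op L *m p = Im_op L by rewrite -Im_mxMr Lp.
have pReL : p *m Re_op L = 0.
  by rewrite -Re_mxMl pL; apply/matrixP => j k; rewrite !mxE.
have pImL : p *m Im_op L = 0.
  by rewrite -Im_mxMl pL; apply/matrixP => j k; rewrite !mxE.
by rewrite -!mulmxA ReLp ImLp !mulmxBl !mul1mx pReL pImL !subr0.
Qed.

Theorem theorem5p6 (R : realType) (n : nat) (n_ge2 : (2 <= n)%N)
    (N : 'rV[R[i]]_n -> R) (N_norm : is_norm N)
    (N_polytope : real_polytope_norm N \/ real_adjoint_polytope_norm N)
    (Y : {vspace 'rV[R[i]]_n}) (Y_proper : proper_nonzero Y)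
    (Y_real : real_subspace Y)
    (P : 'End('rV[R[i]]_n)) (P_minimal : minimal_projection N Y P)
    (P_unique : forall Q : 'End('rV[R[i]]_n),
       minimal_projection N Y Q -> Q = P) :
  real_projection P /\ strongly_unique_minimal 2 N Y P.
Proof.
have NP := polytope_real_polyhedral N_norm N_polytope.
have op0 L : 0 <= op_norm N L := op_norm_ge0 L N_norm NP.
have [PYP P_eq] := P_minimal.
set lam := op_norm N P.
have P_le Q : projection Y Q -> lam <= op_norm N Q.
  move=> QY; rewrite /lam P_eq; apply: ge_inf; last by exists Q.
  by exists 0 => _ [L _ <-].
have P_uniq Q : projection Y Q -> op_norm N Q <= lam -> Q = P.
  move=> QY Q_le; apply: P_unique; split=> //; rewrite -P_eq.
  by apply/eqP; rewrite eq_le Q_le P_le.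
pose p := Re_op P.
have PE : real_op p = P.
  by apply: P_uniq; [exact: Re_op_projection|exact: op_norm_Re_le].
split=> [v vR|].
  by rewrite -PE real_opE -(real_vectorE vR) -complex_mxM; apply: real_vector_complex_mx.
have pY : projection Y (real_op p) by rewrite PE.
pose D Z : 'M[R]_n := (1%:M - p) *m Z *m p.
have [Gs GsP] := real_op_norm_halfspaces N_norm NP.
have Gs_le G : G \in Gs -> forall A, mxdot G A <= op_norm N (real_op A).
  by move=> GGs A; have /(GsP _ _ (op0 _)) := lexx (op_norm N (real_op A)); apply.
pose I := [seq G <- Gs | mxdot G p == lam].
have I0 Z : (forall G, G \in I -> mxdot G (D Z) <= 0) -> D Z = 0.
  (* Functionals outside [I] are below [lam] at [p], so a short step along [D Z] gives a projection
     of norm at most [lam], which must be [P]. *)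
  move=> DZ; have [e e0 eP] : exists2 e, 0 < e &
      forall G, G \in Gs -> mxdot G p + e * mxdot G (D Z) <= lam.
    apply: small_step => G GGs; split; first by rewrite /lam -PE; apply: Gs_le.
    by move=> Gp; apply: DZ; rewrite mem_filter Gp eqxx.
  have : real_op (p + D (e *: Z)) = P.
    apply: P_uniq; first exact: projection_perturb.
    apply/(GsP _ _ (op0 _)) => G GGs.
    by rewrite mxdotDr /D -scalemxAr -scalemxAl mxdotZr eP.
  rewrite -PE => /(congr1 (@Re_op R n)); rewrite !Re_opK => /eqP.
  rewrite -subr_eq0 addrC addKr /D -scalemxAr -scalemxAl scaler_eq0.
  by rewrite gt_eqF //= => /eqP.
have span C := separating_positive_span C I0.
pose g j := I`_j; pose m := size I.
have gI j : (j < m)%N -> g j \in I by move=> jm; rewrite mem_nth.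
have g_le j : (j < m)%N -> forall A, mxdot (g j) A <= op_norm N (real_op A).
  by move=> /gI; rewrite mem_filter => /andP[_ /Gs_le].
have gp j : (j < m)%N -> mxdot (g j) p = lam.
  by move=> /gI; rewrite mem_filter => /andP[/eqP].
(* On these operators the negated sum of [I] is a nonnegative combination of [I]; adding the sum
   back makes every weight at least [1]. *)
have [w w1 w_sum] : exists2 w : nat -> R, (forall j, 1 <= w j) &
    forall Z, \sum_(j < m) w j * mxdot (g j) (D Z) = 0.
  have [c c0 cP] := span (- \sum_(G <- I) G).
  exists (fun j => 1 + c j) => [j|Z]; first by rewrite lerDl.
  rewrite (eq_bigr (fun j : 'I_m => mxdot (g j) (D Z) + c j * mxdot (g j) (D Z))).
    rewrite big_split /= -cP mxdotNl mxdot_suml (big_nth 0) big_mkord.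
    by rewrite subrr.
  by move=> j _; rewrite mulrDl mul1r.
(* On these operators each [G] in [Gs] is a nonnegative combination of [I], so the values of [I]
   control the norm; [K] adds up the coefficients over all of [Gs]. *)
have [K K0 KP] : exists2 K, 0 <= K & forall Z rho, 0 <= rho ->
    (forall j, (j < m)%N -> `|mxdot (g j) (D Z)| <= rho) ->
    op_norm N (real_op (D Z)) <= K * rho.
  suff [K K0 KP] : exists2 K, 0 <= K & forall G Z rho, G \in Gs -> 0 <= rho ->
      (forall j, (j < m)%N -> `|mxdot (g j) (D Z)| <= rho) ->
      mxdot G (D Z) <= K * rho.
    exists K => // Z rho rho0 gZ; apply/GsP => [|G GGs]; first exact: mulr_ge0.
    exact: KP.
  elim: (Gs) => [|G Hs [K K0 KP]]; first by exists 0.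
  have [c c0 cP] := span G.
  have s0 : 0 <= \sum_(j < m) c j by rewrite sumr_ge0.
  exists (K + \sum_(j < m) c j) => [|H Z rho + rho0 gZ]; first exact: addr_ge0.
  rewrite inE mulrDl => /predU1P[->|HHs]; last first.
    by apply: le_trans (KP H Z rho HHs rho0 gZ) _; rewrite lerDl mulr_ge0.
  apply: (@le_trans _ _ ((\sum_(j < m) c j) * rho)); last first.
    by rewrite lerDr mulr_ge0.
  rewrite cP mulr_suml; apply: ler_sum => j _; rewrite ler_wpM2l //.
  exact: le_trans (ler_norm _) (gZ _ (ltn_ord j)).
pose W := \sum_(j < m) w j.
have W0 : 0 <= W by rewrite sumr_ge0 // => j _; apply: le_trans (w1 j).
(* The factors come from [QS] and [L_le] below; the added [1] keeps each denominator positive even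
   if [W] or [K] is [0]. *)
split=> //; exists ((W + 1)^-1 * (4 * K ^+ 2 + 1)^-1).
  by rewrite mulr_gt0 // invr_gt0 ?ltr_pwDr // mulr_ge0 ?sqr_ge0.
move=> Q QY; rewrite !powR_mulrn //.
have := projection_diff pY QY; rewrite PE /=.
set L := Q - P; set A := Re_op L; set B := Im_op L => -[AE BE].
pose S := \sum_(j < m) w j * (mxdot (g j) A ^+ 2 + mxdot (g j) B ^+ 2).
have term0 (j : 'I_m) :
    0 <= w j * (mxdot (g j) A ^+ 2 + mxdot (g j) B ^+ 2).
  by rewrite mulr_ge0 ?addr_ge0 ?sqr_ge0 // (le_trans _ (w1 j)).
have S0 : 0 <= S by rewrite sumr_ge0.
(* Every weight is at least [1], so [S] bounds each squared value; [4] is the square of the [2] from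
   splitting [L] into real and imaginary parts. *)
have L_le : op_norm N L ^+ 2 <= 4 * K ^+ 2 * S.
  pose rho := Num.sqrt S.
  have term_le j : (j < m)%N -> mxdot (g j) A ^+ 2 + mxdot (g j) B ^+ 2 <= S.
    move=> jm; rewrite /S (bigD1 (Ordinal jm)) //=.
    apply: (@le_trans _ _ (w j * (mxdot (g j) A ^+ 2 + mxdot (g j) B ^+ 2))).
      by rewrite ler_peMl // addr_ge0 ?sqr_ge0.
    by rewrite lerDl sumr_ge0.
  have Arho : op_norm N (real_op A) <= K * rho.
    rewrite AE; apply: KP => [|j jm]; first exact: sqrtr_ge0.
    rewrite -[D A]AE -sqrtr_sqr ler_wsqrtr //; apply: le_trans (term_le j jm).
    by rewrite lerDl sqr_ge0.
  have Brho : op_norm N (real_op B) <= K * rho.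
    rewrite BE; apply: KP => [|j jm]; first exact: sqrtr_ge0.
    rewrite -[D B]BE -sqrtr_sqr ler_wsqrtr //; apply: le_trans (term_le j jm).
    by rewrite lerDr sqr_ge0.
  have LAB : op_norm N L <= 2 * K * rho.
    rewrite {1}(op_decomp L); apply: le_trans (op_normD_le _ _ N_norm NP) _.
    have := op_normZ_le 'i%C (real_op B) N_norm NP.
    rewrite normci mul1r -/A -/B; lra.
  have -> : 4 * K ^+ 2 * S = (2 * K * rho) ^+ 2.
    by rewrite !exprMn sqr_sqrtr // -natrX.
  by rewrite ler_pXn2r ?nnegrE // (le_trans _ LAB).
have QS : W * lam ^+ 2 + S <= W * op_norm N Q ^+ 2.
  have QE : Q = real_op p + L by rewrite PE /L addrC subrK.
  have ReQ : Re_op Q = p + A by rewrite QE Re_opD Re_opK.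
  have ImQ : Im_op Q = B by rewrite QE Im_opD Im_real_op add0r.
  (* Inserting the linear terms, whose weighted sum is zero, completes the squares. *)
  rewrite -[leLHS]addr0 -(mulr0 (2 * lam)) -(w_sum A) -[D A]AE.
  rewrite /W /S !mulr_suml mulr_sumr -!big_split /=.
  apply: ler_sum => j _.
  have := real_functional_sqr_le Q N_norm NP (g_le j (ltn_ord j)).
  rewrite ReQ ImQ mxdotDr gp // => h.
  have -> : forall x y, w j * lam ^+ 2 + w j * (x ^+ 2 + y ^+ 2) +
    2 * lam * (w j * x) = w j * ((lam + x) ^+ 2 + y ^+ 2) by move=> x y; ring.
  by rewrite ler_wpM2l // (le_trans _ (w1 j)).
(* This allows [W] to be replaced by [W + 1] in [QS]. *)
have lamQ : lam ^+ 2 <= op_norm N Q ^+ 2.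
  by rewrite ler_pXn2r ?nnegrE ?op0 // P_le.
have K4 : 0 < 4 * K ^+ 2 + 1 by rewrite ltr_pwDr // mulr_ge0 ?sqr_ge0.
rewrite -lerBrDl -mulrA ler_pdivrMl ?ltr_pwDr //.
rewrite ler_pdivrMl //; apply: le_trans L_le _.
apply: (@le_trans _ _ ((4 * K ^+ 2 + 1) * S)); first by rewrite ler_wpM2r // lerDl.
rewrite ler_wpM2l ?(ltW K4) //.
move: QS lamQ; rewrite -/lam mulrDl mul1r mulrBr. lra.
Qed.
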